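(* Let $x\in\Omega$ be an arbitrary point and let $\sigma$ be a needle with tip at $x$. Let $\xi=\{v_n\}$ be an arbitrary needle sequence for $(x,\sigma)$. Then, for any finite cone $V$ with vertex at $x$, $$\lim_{n\to\infty}\int_{V\cap\Omega}|\nabla v_n(y)|^2\,dy=\infty.$$
   Context: $m\in\{2,3\}$, $\Omega\subset\mathbb{R}^m$ is a bounded domain with Lipschitz boundary, $k\ge 0$ is fixed, and $0$ is not a Dirichlet eigenvalue of $\Delta+k^2$ in $\Omega$. Functions are complex valued. $G_k$ denotes the standard fundamental solution of the Helmholtz equation $\Delta u+k^2u=0$ in $\mathbb{R}^m$: $G_k(y)=\frac{e^{ik|y|}}{4\pi|y|}$ if $m=3$; $G_k(y)=\frac{i}{4}H^{(1)}_0(k|y|)$ if $m=2$, $k>0$; $G_0(y)=\frac{1}{2\pi}\log\frac{1}{|y|}$ if $m=2$, $k=0$. Needle: given $x\in\Omega$, a needle with tip at $x$ is a (continuous) piecewise linear curve $\sigma:[0,1]\to\overline\Omega$ that is injective and satisfies $\sigma(0)\in\partial\Omega$, $\sigma(1)=x$ and $\sigma(t)\in\Omega$ for all $t\in\,]0,1[$. Needle sequence: a sequence $\xi=\{v_n\}$ of $H^1(\Omega)$ solutions of $\Delta v_n+k^2v_n=0$ in $\Omega$ is a needle sequence for $(x,\sigma)$ if for each compact set $K\subset\mathbb{R}^m$ with $K\subset\Omega\setminus\sigma([0,1])$, $$\lim_{n\to\infty}\bigl(\|v_n(\cdot)-G_k(\cdot-x)\|_{L^2(K)}+\|\nabla\{v_n(\cdot)-G_k(\cdot-x)\}\|_{L^2(K)}\bigr)=0.$$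 Finite cone: for a nonzero vector $b\in\mathbb{R}^m$, $x\in\mathbb{R}^m$, $\rho>0$, $\theta\in\,]0,\pi[$, the set $$V=\{y\in\mathbb{R}^m : |y-x|<\rho,\ (y-x)\cdot b>|y-x||b|\cos(\theta/2)\}$$ is called a finite cone (of height $\rho$, axis direction $b$, aperture angle $\theta$) with vertex at $x$. *)

(* Defs.v *)
From HB Require Import structures.
From mathcomp Require Import all_boot all_order all_algebra.
From mathcomp Require Import all_classical all_reals all_analysis.
From mathcomp Require Import complex.

Set Implicit Arguments.
Unset Strict Implicit.
Unset Printing Implicit Defensive.

Import Order.TTheory GRing.Theory Num.Theory.
Import numFieldNormedType.Exports.

Local Open Scope classical_set_scope.
Local Open Scope ring_scope.
Local Open Scope complex_scope.

(* The sigma-algebra on R^n generated by the coordinate functions, that is, the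
   Borel sigma-algebra, as for n.-tuple in measurable_structure.v *)
Definition measure_rV_display : measure_display -> measure_display.
Proof. exact. Qed.

Section measurable_rV.
Variables (R : realType) (n : nat).

Let coors : 'I_n -> 'rV[R]_n -> R := fun i v => v ord0 i.

Let rV_set0 : g_sigma_preimage coors set0.
Proof. exact: sigma_algebra0. Qed.

Let rV_setC A : g_sigma_preimage coors A -> g_sigma_preimage coors (~` A).
Proof. exact: sigma_algebraC. Qed.

Let rV_bigcup (F : _^nat) : (forall i, g_sigma_preimage coors (F i)) ->
  g_sigma_preimage coors (\bigcup_i (F i)).
Proof. exact: sigma_algebra_bigcup. Qed.

HB.instance Definition _ :=
  @isMeasurable.Build (measure_rV_display default_measure_display)
    'rV[R]_n (g_sigma_preimage coors) rV_set0 rV_setC rV_bigcup.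

End measurable_rV.

Lemma measurable_coord_rV (R : realType) n (i : 'I_n) :
  measurable_fun [set: 'rV[R]_n] (fun v => v ord0 i).
Proof.
move=> _ Y mY; rewrite setTI; apply: sub_sigma_algebra => /=.
rewrite -bigcup_seq/=; exists i => /=; first by rewrite mem_index_enum.
by exists Y => //; rewrite setTI.
Qed.

Lemma measurable_fun_rVP d (T : measurableType d) (R : realType) n
    (f : T -> 'rV[R]_n) :
  (forall i, measurable_fun [set: T] (fun x => f x ord0 i)) ->
  measurable_fun [set: T] f.
Proof.
move=> mf _ A mA; rewrite setTI.
suff : preimage_set_system setT f measurable `<=` @measurable _ T.
  by apply; exists A => //; rewrite setTI.
rewrite /= -g_sigma_preimage_comp.
apply: smallest_sub; first exact: sigma_algebra_measurable.
rewrite -bigcup_seq => B [i _] [C mC <-].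
exact: mf.
Qed.

Definition rV_cons (R : realType) n (p : R * 'rV[R]_n) : 'rV[R]_n.+1 :=
  \row_i (if unlift ord0 i is Some j then p.2 ord0 j else p.1).

Section lebesgue_rV_step.
Context (R : realType) (n : nat).
Variable mu : {sigma_finite_measure set 'rV[R]_n -> \bar R}.
Local Open Scope ereal_scope.

Definition lebesgue_rV_step : set 'rV[R]_n.+1 -> \bar R :=
  fun A => (lebesgue_measure \x mu) (@rV_cons R n @^-1` A).

Lemma measurable_rV_cons : measurable_fun setT (@rV_cons R n).
Proof.
apply: measurable_fun_rVP => i.
rewrite [X in measurable_fun _ X](_ : _ = (fun p : R * 'rV[R]_n =>
    if unlift ord0 i is Some j then p.2 ord0 j else p.1)); last first.
  by apply/funext => p; rewrite mxE.
case: unliftP => [j _|_]; last exact: measurable_fst.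
exact: (measurableT_comp (@measurable_coord_rV R n j) measurable_snd).
Qed.

Let step0 : lebesgue_rV_step set0 = 0.
Proof. by rewrite /lebesgue_rV_step preimage_set0 measure0. Qed.

Let step_ge0 A : 0 <= lebesgue_rV_step A.
Proof. exact: measure_ge0. Qed.

Let mcons A : measurable A -> measurable (@rV_cons R n @^-1` A).
Proof.
by move=> mA; rewrite -[X in measurable X]setTI; exact: measurable_rV_cons.
Qed.

Let step_sigma_additive : semi_sigma_additive lebesgue_rV_step.
Proof.
move=> F mF tF mUF; rewrite /lebesgue_rV_step preimage_bigcup.
apply: measure_semi_sigma_additive.
- by move=> k; exact: mcons.
- apply/trivIsetP => /= i j _ _ ij; rewrite -preimage_setI.
  by move/trivIsetP : tF => /(_ _ _ _ _ ij) ->//; rewrite preimage_set0.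
- by rewrite -preimage_bigcup; exact: mcons.
Qed.

HB.instance Definition _ := isMeasure.Build _ _ _ lebesgue_rV_step
  step0 step_ge0 step_sigma_additive.

Let rV_head (v : 'rV[R]_n.+1) : R := v ord0 ord0.
Let rV_tail (v : 'rV[R]_n.+1) : 'rV[R]_n := \row_j v ord0 (lift ord0 j).

Let step_sigma_finite : sigma_finite setT lebesgue_rV_step.
Proof.
have /sigma_finiteP[F1 [TF1 ndF1 F1oo]] :=
  sigma_finiteT (@lebesgue_measure R).
have /sigma_finiteP[F2 [TF2 ndF2 F2oo]] := sigma_finiteT mu.
pose F k := F1 k `*` F2 k.
have TF : setT = \bigcup_k F k.
  rewrite -setXTT TF1 TF2 predeqE => -[x y]; split.
    move=> [/= [i _ Fix] [j _ Fjy]]; exists (maxn i j) => //; split.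
    - by move: x Fix; exact/subsetPset/ndF1/leq_maxl.
    - by move: y Fjy; exact/subsetPset/ndF2/leq_maxr.
  by move=> [i _ []/= ? ?]; split; exists i.
have Foo k : measurable (F k) /\ (lebesgue_measure \x mu) (F k) < +oo.
  have [? ?] := F1oo k; have [? ?] := F2oo k; split; first exact: measurableX.
  by rewrite product_measure1E// lte_mul_pinfty// ge0_fin_numE.
have mht : measurable_fun setT (fun v => (rV_head v, rV_tail v)).
  apply/measurable_fun_pairP; split; first exact: measurable_coord_rV.
  apply: measurable_fun_rVP => i.
  rewrite [X in measurable_fun _ X](_ : _ =
      (fun v : 'rV[R]_n.+1 => v ord0 (lift ord0 i))).
    exact: measurable_coord_rV.
  by apply/funext => v; rewrite /= mxE.
pose G k := (fun v => (rV_head v, rV_tail v)) @^-1` F k.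
exists G; first by rewrite -preimage_bigcup -TF preimage_setT.
move=> k; have [mF Fk] := Foo k; split.
  by rewrite -[X in measurable X]setTI; exact: mht.
rewrite /lebesgue_rV_step (_ : _ @^-1` _ = F k)//.
have consK p : (rV_head (rV_cons p), rV_tail (rV_cons p)) = p.
  case: p => a v; rewrite /rV_head /rV_tail mxE unlift_none/=; congr pair.
  by apply/rowP => j; rewrite !mxE liftK.
by rewrite predeqE => p; rewrite /G /= consK.
Qed.

HB.instance Definition _ := Measure_isSigmaFinite.Build _ _ _ lebesgue_rV_step
  step_sigma_finite.

End lebesgue_rV_step.

(* R^0 is a single point, of measure 1 *)
Fixpoint lebesgue_rV (R : realType) n :
    {sigma_finite_measure set 'rV[R]_n -> \bar R} :=
  if n is n'.+1 then lebesgue_rV_step (lebesgue_rV R n') else \d_(0 : 'rV[R]_0).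

Lemma lebesgue_rV_box (R : realType) n (A : 'I_n -> set R) :
  (forall i, measurable (A i)) ->
  measurable [set v : 'rV[R]_n | forall i, A i (v ord0 i)] /\
  lebesgue_rV R n [set v : 'rV[R]_n | forall i, A i (v ord0 i)] =
    (\prod_(i < n) lebesgue_measure (A i))%E.
Proof.
elim: n A => [|n IHn] A mA.
  rewrite (_ : mkset _ = setT); last by rewrite predeqE => v; split => // _ [].
  by split; [exact: measurableT|rewrite big_ord0; exact: diracT].
have mbox : measurable [set v : 'rV[R]_n.+1 | forall i, A i (v ord0 i)].
  rewrite (_ : mkset _ = \bigcap_(i in [set: 'I_n.+1])
      (fun v : 'rV[R]_n.+1 => v ord0 i) @^-1` A i); last first.
    by rewrite predeqE => v; split => [Av i _|Av i]; exact: Av.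
  apply: fin_bigcap_measurable => [|i _]; first exact: finite_finset.
  by rewrite -[X in measurable X]setTI; exact: measurable_coord_rV.
split => //=.
have [mB muB] := IHn (fun i => A (lift ord0 i)) (fun i => mA _).
rewrite big_ord_recl /=.
rewrite /lebesgue_rV_step (_ : _ @^-1` _ = A ord0 `*`
    [set v : 'rV[R]_n | forall i, A (lift ord0 i) (v ord0 i)]).
  rewrite product_measure1E//; last exact: mA.
  by rewrite -muB.
rewrite predeqE => -[a v]; split => [Av|[Aa Av] i] /=.
  split => /= [|i]; first by have := Av ord0; rewrite mxE unlift_none.
  by have := Av (lift ord0 i); rewrite mxE liftK.
by rewrite mxE; case: unliftP => [j ->|->]//=; exact: Av.
Qed.

Section euclidean.
Context {R : realType} {m : nat}.
Implicit Types (u v : 'rV[R]_m) (A : set 'rV[R]_m).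

Definition dotr u v : R := \sum_j u 0 j * v 0 j.

(* The norm `|v| of the library on 'rV[R]_m is the sup norm (same topology) *)
Definition enorm v : R := Num.sqrt (dotr v v).

Definition cnorm (z : 'rV[R[i]]_m) : R :=
  Num.sqrt (\sum_j Normc.normc (z 0 j) ^+ 2).

Definition boundary A : set 'rV[R]_m := closure A `\` A°.

Definition bounded_domain A : Prop :=
  [/\ A !=set0, open A, connected A & bounded_set A].

(* Near each boundary point p, and after a change of orthonormal coordinates
   whose last vector is e, A is the strict epigraph of the Lipschitz function g
   of the first m - 1 coordinates. These are represented by the orthogonal
   projection onto the hyperplane e^\perp, so g is only evaluated there. *)
Definition Lipschitz_boundary A : Prop :=
  forall p, boundary A p -> exists (r : R) (e : 'rV[R]_m) (g : 'rV[R]_m -> R),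
    [/\ 0 < r, enorm e = 1, lipschitz g &
      forall y, enorm (y - p) < r ->
        (A y <-> g ((y - p) - dotr (y - p) e *: e) < dotr (y - p) e)].

Definition finite_cone (x b : 'rV[R]_m) (rho theta : R) : set 'rV[R]_m :=
  [set y | enorm (y - x) < rho /\
           dotr (y - x) b > enorm (y - x) * enorm b * cos (theta / 2)].

Definition piecewise_linear (sigma : R -> 'rV[R]_m) : Prop :=
  {within `[0, 1], continuous sigma} /\
  exists2 s, itv_partition 0 1 s &
    forall i, (i < size s)%N -> exists a d : 'rV[R]_m,
      forall t, nth 0 (0 :: s) i <= t <= nth 0 s i -> sigma t = a + t *: d.

Definition needle (Omega : set 'rV[R]_m) (x : 'rV[R]_m)
    (sigma : R -> 'rV[R]_m) : Prop :=
  [/\ piecewise_linear sigma,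
      {in `[0, 1] &, injective sigma},
      (forall t, t \in `[0, 1] -> closure Omega (sigma t)),
      boundary Omega (sigma 0) /\ sigma 1 = x &
      forall t, t \in `]0, 1[ -> Omega (sigma t)].

End euclidean.

Section fundamental_solution.
Context {R : realType}.

Definition Euler_gamma : R := limn (fun n => series harmonic n - ln n%:R).

Definition Bessel_J0 (z : R) : R :=
  limn (pseries (fun n => (-1) ^+ n / n`!%:R ^+ 2) (z ^+ 2 / 4)).

(* series harmonic n = 1 + 1/2 + ... + 1/n *)
Definition Bessel_Y0 (z : R) : R :=
  2 / pi * ((ln (z / 2) + Euler_gamma) * Bessel_J0 z -
    limn (pseries (fun n => (-1) ^+ n * series harmonic n / n`!%:R ^+ 2)
                  (z ^+ 2 / 4))).

(* Hankel function of the first kind of order 0, for z > 0 *)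
Definition Hankel1_0 (z : R) : R[i] := Bessel_J0 z +i* Bessel_Y0 z.

Definition expi (t : R) : R[i] := cos t +i* sin t.

(* Only meaningful for m = 2 and m = 3 *)
Definition fund_sol (k : R) m (y : 'rV[R]_m) : R[i] :=
  if m == 3%N then expi (k * enorm y) / (4 * pi * enorm y)%:C
  else if k == 0 then ((2 * pi)^-1 * ln (enorm y)^-1)%:C
  else 'i%C / 4 * Hankel1_0 (k * enorm y).

End fundamental_solution.

Section sobolev.
Context {R : realType} {m : nat}.
Implicit Types (Omega A : set 'rV[R]_m) (u : 'rV[R]_m -> R[i])
  (g : 'rV[R]_m -> 'rV[R[i]]_m) (phi : 'rV[R]_m -> R).

Definition partial (j : 'I_m) phi : 'rV[R]_m -> R := 'D_(delta_mx 0 j) phi.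

Definition smooth phi : Prop :=
  forall s : seq 'I_m,
    let dphi := foldr partial phi s in
    continuous dphi /\
    forall (j : 'I_m) (y : 'rV[R]_m), derivable dphi y (delta_mx 0 j).

Definition test_fun Omega phi : Prop :=
  smooth phi /\
  exists K, [/\ compact K, K `<=` Omega & forall y, ~ K y -> phi y = 0].

Definition cgrad u : 'rV[R]_m -> 'rV[R[i]]_m := fun y =>
  \row_j (partial j (@complex.Re R \o u) y +i* partial j (@complex.Im R \o u) y).

Definition cintegral A u : R[i] :=
  (\int[lebesgue_rV R m]_(y in A) complex.Re (u y)) +i*
  (\int[lebesgue_rV R m]_(y in A) complex.Im (u y)).

Definition L2norm A (f : 'rV[R]_m -> R) : \bar R :=
  'N[lebesgue_rV R m]_(2%:E)[(EFin \o f) \_ A].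

(* g plays the role of the gradient of u *)
Definition H1norm A u g : \bar R :=
  (L2norm A (@Normc.normc R \o u) + L2norm A (@cnorm R m \o g))%E.

Definition L2 A u : Prop :=
  [/\ measurable_fun A (@complex.Re R \o u), measurable_fun A (@complex.Im R \o u) &
      (L2norm A (@Normc.normc R \o u) < +oo)%E].

Definition is_weak_grad Omega u g : Prop :=
  (forall j, L2 Omega (fun y => g y 0 j)) /\
  forall phi, test_fun Omega phi -> forall j,
    cintegral Omega (fun y => u y * (partial j phi y)%:C) =
    - cintegral Omega (fun y => g y 0 j * (phi y)%:C).

Definition H1 Omega u : Prop :=
  L2 Omega u /\ exists g, is_weak_grad Omega u g.

(* The weak gradient of u in H1 Omega, unique up to a null set *)
Definition wgrad Omega u : 'rV[R]_m -> 'rV[R[i]]_m :=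
  xget (fun=> 0) [set g | is_weak_grad Omega u g].

(* H^1_0: the closure in H^1 of the smooth compactly supported functions *)
Definition H10 Omega u : Prop :=
  H1 Omega u /\
  exists phi : nat -> 'rV[R]_m -> R[i],
    (forall n, test_fun Omega (@complex.Re R \o phi n) /\
               test_fun Omega (@complex.Im R \o phi n)) /\
    H1norm Omega (phi n \- u) (cgrad (phi n) \- wgrad Omega u)
      @[n --> \oo] --> 0%E.

(* Delta u + c u = 0 in Omega, in the weak sense *)
Definition Helmholtz_solution Omega (c : R) u : Prop :=
  forall phi, test_fun Omega phi ->
    - (\sum_j cintegral Omega
         (fun y => wgrad Omega u y 0 j * (partial j phi y)%:C)) +
    c%:C * cintegral Omega (fun y => u y * (phi y)%:C) = 0.

(* lam is a Dirichlet eigenvalue of Delta + k^2: some nonzero u in H^1_0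
   satisfies Delta u + k^2 u = lam u *)
Definition Dirichlet_eigenvalue Omega (k lam : R) : Prop :=
  exists u, [/\ H10 Omega u,
    ~ {ae lebesgue_rV R m, forall y, Omega y -> u y = 0} &
    Helmholtz_solution Omega (k ^+ 2 - lam) u].

Definition needle_sequence Omega (k : R) (x : 'rV[R]_m)
    (sigma : R -> 'rV[R]_m) (v : nat -> 'rV[R]_m -> R[i]) : Prop :=
  (forall n, H1 Omega (v n) /\ Helmholtz_solution Omega (k ^+ 2) (v n)) /\
  let Gx := fun y : 'rV[R]_m => fund_sol k (y - x) in
  forall K : set 'rV[R]_m, compact K ->
    K `<=` Omega `\` sigma @` `[0, 1] ->
    H1norm K (v n \- Gx) (wgrad Omega (v n) \- cgrad Gx)
      @[n --> \oo] --> 0%E.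

End sobolev.

(* Main.v *)
(* Close to x the needle is a segment, so V contains a cone V' with vertex x,
   inside Omega, that misses the needle. The gradient of G_k(. - x) is of order
   |y - x|^(1-m) near x. Put in V' disjoint cubes K_i of side proportional to
   t_i = t_0 / 4^i at distance proportional to t_i from x: the integral of
   |grad G_k|^2 over K_i is at least of order t_i^(2-2m) t_i^m >= 1, uniformly
   in i. As grad v_n converges to grad G_k in L^2(K_i), the integral of
   |grad v_n|^2 over K_i is eventually at least a fixed eta > 0, so for each N
   the integral over V is eventually at least N eta. *)
Require Import Defs.
From HB Require Import structures.
From mathcomp Require Import all_boot all_order all_algebra.
From mathcomp Require Import all_classical all_reals all_analysis.
From mathcomp Require Import measurable_realfun complex.
From mathcomp Require Import ring lra.

Set Implicit Arguments.
Unset Strict Implicit.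
Unset Printing Implicit Defensive.

Import Order.TTheory GRing.Theory Num.Theory.
Import numFieldNormedType.Exports HBNNSimple.

Local Open Scope classical_set_scope.
Local Open Scope ring_scope.

(** * Lower bounds for integrals and their stability under L^2 perturbation *)

Section measure.
Context d (T : measurableType d) (R : realType) (mu : {measure set T -> \bar R}).

(** The integral of a nonnegative function is a supremum over the simple functions below it, and [c]
    times the indicator of [E] is one of them. The bound thus also serves functions whose
    measurability is unknown. *)
Lemma le_mul_measure_integral (A E : set T) (f : T -> \bar R) (c : R) :
  measurable E -> E `<=` A -> (forall y, A y -> 0 <= f y)%E -> 0 <= c ->
  (forall y, E y -> c%:E <= f y)%E ->
  (c%:E * mu E <= \int[mu]_(y in A) f y)%E.
Proof.
move=> mE EA f0 c0 cf.
have sE y : scale_nnsfun (indic_nnsfun R mE) c0 y = c * \1_E y by [].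
have -> : (c%:E * mu E =
    \int[mu]_(y in setT) (scale_nnsfun (indic_nnsfun R mE) c0 y)%:E)%E.
  rewrite -integral_cst// [LHS]integral_mkcond; apply: eq_integral => y _.
  by rewrite sE patchE indicE; case: ifPn => _; rewrite ?mulr1 ?mulr0.
rewrite integralT_nnsfun// (ge0_integralE _ f0).
apply: ereal_sup_ubound => /=; exists (scale_nnsfun (indic_nnsfun R mE) c0) => //.
move=> y; rewrite sE patchE indicE.
have [yE|yE] := boolP (y \in E).
  have Ey := set_mem yE; rewrite mem_set ?mulr1; [exact: cf|exact: EA].
rewrite mulr0; case: ifPn => // /set_mem; exact: f0.
Qed.

(** Where [g n] is below [c / 2], [h n] is above it; once [h n] has small L^2 norm this happens on
    at most half of [K]. On the rest the square of [g n] is at least c^2/4, which gives the constant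
    as c^2/4 times M/2. *)
Lemma near_integral_sqr_ge (K : set T) (M c : R) (g h : nat -> T -> R) :
  measurable K -> mu K = M%:E -> 0 < M -> 0 < c ->
  (forall n, measurable_fun K (g n)) ->
  (forall n y, K y -> c <= g n y + h n y) ->
  ('N[mu]_(2%:E)[(EFin \o h n) \_ K])%E @[n --> \oo] --> 0%E ->
  \forall n \near \oo,
    ((c ^+ 2 * M / 8)%:E <= \int[mu]_(y in K) ((g n y) ^+ 2)%:E)%E.
Proof.
move=> mK muK M0 c0 mg cgh h0.
(* Chebyshev's inequality for h; it does not require h to be measurable. *)
have e0 : 0 < c ^+ 2 * M / 8 by rewrite divr_gt0// mulr_gt0// exprn_gt0.
have s0 : 0 < Num.sqrt (c ^+ 2 * M / 8) by rewrite sqrtr_gt0.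
have small : \forall n \near \oo,
    ('N[mu]_(2%:E)[(EFin \o h n) \_ K] < (Num.sqrt (c ^+ 2 * M / 8))%:E)%E.
  apply: (h0 [set z | (z < (Num.sqrt (c ^+ 2 * M / 8))%:E)%E]).
  apply: open_nbhs_nbhs; split; last by rewrite /= lte_fin.
  exact: open_ereal_lt_ereal.
near=> n.
pose E := K `&` [set y | c / 2 <= g n y].
have mE : measurable E.
  have -> : E = K `&` g n @^-1` `[c / 2, +oo[.
    by congr setI; apply/funext => y; rewrite /= in_itv/= andbT.
  exact: mg.
have mD : measurable (K `\` E) by exact: measurableD.
have D2 : (((c / 2) ^+ 2)%:E * mu (K `\` E) <= (c ^+ 2 * M / 8)%:E)%E.
  apply: (@le_trans _ _ ('N[mu]_(2%:E)[(EFin \o h n) \_ K] `^ 2)%E).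
    rewrite poweR_Lnorm//.
    apply: le_mul_measure_integral => // [y _|| y [Ky nE]].
    - exact: poweR_ge0.
    - exact: sqr_ge0.
    rewrite patchE mem_set//= -powR_mulrn; last by lra.
    rewrite lee_fin ge0_ler_powR// ?nnegrE; first by lra.
    have := cgh n y Ky.
    have : ~~ (c / 2 <= g n y) by apply/negP => ?; apply: nE.
    rewrite -ltNge => /ltW; have := ler_norm (h n y); lra.
  have -> : (c ^+ 2 * M / 8)%:E = ((Num.sqrt (c ^+ 2 * M / 8))%:E `^ 2)%E.
    by rewrite poweR_EFin powR_mulrn ?sqrtr_ge0// sqr_sqrtr// ltW.
  apply: gt0_ler_poweR => //;
    rewrite ?in_itv/= ?andbT ?leey ?Lnorm_ge0 ?lee_fin ?sqrtr_ge0//.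
  by apply: ltW; near: n.
have KE : mu K = (mu E + mu (K `\` E))%E.
  rewrite -measureU//; last by rewrite setDIK.
  by rewrite setDUK//; exact: subIsetl.
apply: (@le_trans _ _ (((c / 2) ^+ 2)%:E * mu E)%E); last first.
  apply: le_mul_measure_integral => //.
  - exact: subIsetl.
  - by move=> y _; rewrite lee_fin sqr_ge0.
  - exact: sqr_ge0.
  move=> y [Ky cg]; rewrite lee_fin ler_sqr ?nnegrE//; rewrite /= in cg; lra.
(* Finiteness turns the splitting of [mu K] into an equation between reals. *)
have Efin : mu E \is a fin_num.
  rewrite ge0_fin_numE// (@le_lt_trans _ _ (mu K))//.
    by rewrite KE leeDl.
  by rewrite muK ltry.
have Dfin : mu (K `\` E) \is a fin_num.
  rewrite ge0_fin_numE// (@le_lt_trans _ _ (mu K))//.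
    by rewrite KE leeDr.
  by rewrite muK ltry.
move: D2 KE; rewrite muK -(fineK Efin) -(fineK Dfin).
rewrite -EFinD -!EFinM !lee_fin => D2 [KE].
have -> : fine (mu E) = M - fine (mu (K `\` E)) by rewrite KE addrK.
rewrite mulrBr; move: D2; lra.
Unshelve. all: by end_near. Qed.

End measure.

(** The sigma-algebra is generated by the coordinates, so an open set is exhibited as the countable
    union of the boxes with rational centre and half-width 1/(n+1) that it contains. *)
Lemma open_measurable_rV (R : realType) n (A : set 'rV[R]_n) :
  open A -> measurable A.
Proof.
move=> oA.
pose itv (p : 'rV[rat]_n * nat) (i : 'I_n) : interval R :=
  `](ratr (p.1 0 i) - p.2.+1%:R^-1), (ratr (p.1 0 i) + p.2.+1%:R^-1)[.
pose box (p : 'rV[rat]_n * nat) : set 'rV[R]_n :=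
  [set v | forall i, v 0 i \in itv p i].
have mbox p : measurable (box p).
  by have [] := @lebesgue_rV_box R n (fun i => [set` itv p i])
    (fun=> measurable_itv _).
have -> : A = \bigcup_(p in [set p | box p `<=` A]) box p.
  apply/seteqP; split => [v Av|v [p pA] /pA//].
  have /nbhs_ballP[e /= e0 eA] : nbhs v A by exact: open_nbhs_nbhs.
  (* Two points of a box of half-width 1/(N+1) are then less than [e] apart in the sup norm. *)
  have [N _ N1] : \forall k \near \oo, k.+1%:R^-1 < e / 2 :> R.
    apply: (near_infty_natSinv_lt (PosNum (divr_gt0 e0 (ltr0n R 2)))).
  have {N1} N1 := N1 N (leqnn N).
  have /boolp.choice[q qv] (i : 'I_n) : exists q : rat,
      (ratr q : R) \in `](v 0 i - N.+1%:R^-1), (v 0 i + N.+1%:R^-1)[.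
    have [|q] := @rat_in_itvoo R (v 0 i - N.+1%:R^-1) (v 0 i + N.+1%:R^-1).
      have N0 : 0 < N.+1%:R^-1 :> R by rewrite invr_gt0 ltr0n.
      by rewrite ltrD2l (lt_trans _ N0)// oppr_lt0.
    by exists q.
  exists (\row_i q i, N); last first.
    by move=> i /=; have := qv i; rewrite /itv/= mxE !in_itv/= -!ltr_distl distrC.
  move=> w wb; apply: eA; split => // i j; rewrite (ord1 i).
  have := qv j; have := wb j; rewrite /itv/= mxE !in_itv/= -!ltr_distl distrC.
  move=> qw vq; rewrite /ball/=.
  rewrite -(subrKA (ratr (q j))) (le_lt_trans (ler_normD _ _))//.
  by rewrite (distrC (v 0 j)) (splitr e) ltrD// (lt_trans _ N1).
rewrite bigcup_mkcond; apply: countable_bigcupT_measurable => // p.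
by case: ifP.
Qed.

(** * Entire power series with factorially decaying coefficients *)

Section pseries_inv_fact.
Context {R : realType}.
Implicit Types (c : R^nat) (x : R).

(** Comparison with the exponential series gives convergence everywhere, and the bound passes to the
    derived series because (n+1)/(n+1)! = 1/n!. Both series in the Bessel functions satisfy it. *)
Definition inv_fact_bounded c := forall n, `|c n| <= n`!%:R^-1.

Lemma cvg_pseries_inv_fact c x : inv_fact_bounded c -> cvgn (pseries c x).
Proof.
move=> cle; apply: normed_cvg.
apply: (@series_le_cvg _ _ (exp_coeff `|x|)) => [n|n|n|].
- exact: normr_ge0.
- exact: exp_coeff_ge0.
- by rewrite /= normrM normrX /exp_coeff mulrC ler_wpM2l ?exprn_ge0.
- exact: is_cvg_series_exp_coeff.
Qed.

Lemma inv_fact_bounded_diffs c :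
  inv_fact_bounded c -> inv_fact_bounded (pseries_diffs c).
Proof.
move=> cle n; rewrite /pseries_diffs normrM normr_nat.
rewrite (le_trans (ler_wpM2l _ (cle _)))// factS natrM invfM mulVKf//.
Qed.

Lemma is_derive_pseries_inv_fact c x : inv_fact_bounded c ->
  is_derive x 1 (fun z => limn (pseries c z)) (limn (pseries (pseries_diffs c) x)).
Proof.
move=> cle; apply: (@pseries_snd_diffs _ _ (`|x| + 1)).
- exact: cvg_pseries_inv_fact.
- exact/cvg_pseries_inv_fact/inv_fact_bounded_diffs.
- exact/cvg_pseries_inv_fact/inv_fact_bounded_diffs/inv_fact_bounded_diffs.
- by rewrite [ltRHS]ger0_norm ?ltrDl// addr_ge0.
Qed.

Lemma continuous_pseries_inv_fact c : inv_fact_bounded c ->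
  continuous (fun z => limn (pseries c z)).
Proof.
move=> cle x; apply/differentiable_continuous/derivable1_diffP.
by have [] := is_derive_pseries_inv_fact x cle.
Qed.

Lemma pseries_at0 c : limn (pseries c 0) = c 0.
Proof.
apply: cvg_lim => //; apply: cvg_near_cst; exists 1%N => // -[//|n] _.
rewrite /pseries /series/= big_nat_recl// expr0 mulr1 big1 ?addr0// => i _.
by rewrite expr0n mulr0.
Qed.

End pseries_inv_fact.

(** * Radial derivatives and the singularity of the fundamental solution *)

Section radial.
Context {R : realType}.

(** The two difference quotients are the same function of [h], so partial derivatives reduce to
    one-variable calculus. *)
Lemma is_derive_line {m} (f : 'rV[R]_m -> R) (a v : 'rV[R]_m) (d : R) :
  is_derive (0 : R) 1 (fun h => f (h *: v + a)) d -> is_derive a v f d.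
Proof.
move=> [fd <-].
have E : (fun h : R =>
    h^-1 *: (((fun h => f (h *: v + a)) \o shift 0) (h *: 1) - f (0 *: v + a))) =
      (fun h : R => h^-1 *: ((f \o shift a) (h *: v) - f a)).
  apply/funext => h /=.
  by rewrite /shift/= scale0r add0r addr0 [h%:A]mulr1.
move: fd; rewrite /derivable E => fd.
by apply: DeriveDef; rewrite // /derive E.
Qed.

Lemma sqr_enorm {m} (z : 'rV[R]_m) : enorm z ^+ 2 = dotr z z.
Proof.
by rewrite sqr_sqrtr// /dotr sumr_ge0// => i _; rewrite -expr2 sqr_ge0.
Qed.

Lemma dotr_line {m} (z : 'rV[R]_m) j (h : R) :
  dotr (h *: delta_mx 0 j + z) (h *: delta_mx 0 j + z) =
  h ^+ 2 + 2 * z 0 j * h + dotr z z.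
Proof.
rewrite /dotr (bigD1 j)//= [in RHS](bigD1 j)//= !mxE !eqxx.
rewrite (eq_bigr (fun i => z 0 i * z 0 i)) => [/=|i ij]; first by ring.
by rewrite !mxE (negPf ij) andbF mulr0 add0r.
Qed.

(** Along the line through [y] in direction j, the distance to [x] is the square root of a quadratic
    polynomial, positive at 0 with derivative 2 (y - x)_j there; the chain rule applies. *)
Lemma is_derive_radial {m} (F : R -> R) (df : R) (x y : 'rV[R]_m) (j : 'I_m) :
  0 < enorm (y - x) -> is_derive (enorm (y - x)) 1 F df ->
  is_derive y (delta_mx 0 j) (fun y => F (enorm (y - x)))
    (df * ((y - x) 0 j / enorm (y - x))).
Proof.
move=> r0 dF; apply: is_derive_line.
set z := y - x in r0 dF *.
have -> : (fun h : R => F (enorm (h *: delta_mx 0 j + y - x))) =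
    F \o (Num.sqrt \o (fun h => h ^+ 2 + 2 * z 0 j * h + dotr z z)).
  by apply/funext => h; rewrite /= /enorm -addrA dotr_line.
have q0 : (0 : R) ^+ 2 + 2 * z 0 j * 0 + dotr z z = enorm z ^+ 2.
  by rewrite sqr_enorm expr0n mulr0 !add0r.
have dq : is_derive (0 : R) 1
    (fun h => h ^+ 2 + 2 * z 0 j * h + dotr z z) (2 * z 0 j).
  apply: is_derive_eq; rewrite /GRing.scale/=; ring.
apply: is_derive1_comp.
  by rewrite /= q0 sqrtr_sqr gtr0_norm.
have -> : z 0 j / enorm z = (2 * Num.sqrt (enorm z ^+ 2))^-1 * (2 * z 0 j).
  rewrite sqrtr_sqr gtr0_norm// invfM; field; exact: lt0r_neq0.
apply: is_derive1_comp.
by rewrite q0; apply: is_derive1_sqrt; rewrite exprn_gt0.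
Qed.

Lemma Re_mulCr (z : R[i]) (c : R) : complex.Re (z * c%:C%C) = complex.Re z * c.
Proof. by case: z => a b /=; rewrite mulr0 subr0. Qed.

Lemma Re_fund_sol3 (k : R) (y : 'rV[R]_3) :
  complex.Re (fund_sol k y) = cos (k * enorm y) / (4 * pi * enorm y).
Proof. by rewrite /fund_sol -fmorphV Re_mulCr. Qed.

(** The factor i/4 moves [Bessel_Y0], which carries the logarithm, into the real part. Hence real
    parts suffice to see the singularity. *)
Lemma Re_fund_sol2 (k : R) (y : 'rV[R]_2) : k != 0 ->
  complex.Re (fund_sol k y) = - Bessel_Y0 (k * enorm y) / 4.
Proof.
move=> k0; rewrite /fund_sol/= (negPf k0).
have -> : 4 = (4 : R)%:C%C by rewrite rmorph_nat.
rewrite -fmorphV mulrAC Re_mulCr /=; congr (_ / _).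
by rewrite mul0r sub0r mul1r.
Qed.

Definition J0_coef (n : nat) : R := (-1) ^+ n / n`!%:R ^+ 2.
Definition Y0_coef (n : nat) : R := (-1) ^+ n * series harmonic n / n`!%:R ^+ 2.

Lemma fact_ge1 n : 1 <= n`!%:R :> R.
Proof. by rewrite ler1n fact_gt0. Qed.

Lemma J0_coef_bounded : inv_fact_bounded J0_coef.
Proof.
move=> n; rewrite /J0_coef normrM normrX normrN1 expr1n mul1r.
rewrite ger0_norm ?invr_ge0 ?exprn_ge0// lef_pV2 ?posrE ?exprn_gt0 ?ltr0n ?fact_gt0//.
by rewrite expr2 ler_peMl// fact_ge1.
Qed.

(** The harmonic sum is at most n, hence at most n!, and is absorbed by one of the two
    factorials. *)
Lemma Y0_coef_bounded : inv_fact_bounded Y0_coef.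
Proof.
move=> n; rewrite /Y0_coef !normrM normrX normrN1 expr1n mul1r.
have H0 : 0 <= series harmonic n :> R.
  by rewrite /series/= sumr_ge0// => i _; rewrite invr_ge0.
have Hn : series harmonic n <= n`!%:R :> R.
  apply: (@le_trans _ _ n%:R).
    rewrite -[n in leRHS]card_ord -sum1_card natr_sum /series/= big_mkord.
    by apply: ler_sum => i _; rewrite invf_le1 ?ler1n.
  by rewrite ler_nat; case: n {H0} => // n; rewrite factS leq_pmulr// fact_gt0.
rewrite !ger0_norm// ?invr_ge0 ?exprn_ge0//.
rewrite expr2 invfM mulrA ler_piMl ?invr_ge0//.
by rewrite ler_pdivrMr ?mul1r// ltr0n fact_gt0.
Qed.

(** For 0 < r < 1, |ln r| = ln (1/r) < 1/r, so the product is at most r in absolute value. *)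
Lemma cvg_sqr_ln : r ^+ 2 * ln r @[r --> (0 : R)^'+] --> 0.
Proof.
apply/cvgrPdist_le => e e0; near=> r.
have r0 : 0 < r by near: r; exact: nbhs_right_gt.
have r1 : r < 1 by near: r; exact: nbhs_right_lt.
have re : r <= e by near: r; exact: nbhs_right_le.
rewrite sub0r normrN normrM ger0_norm ?sqr_ge0//.
rewrite (ler0_norm (ln_le0 (ltW r1))) -lnV ?posrE//.
rewrite (le_trans _ re)// (le_trans (ler_wpM2l (sqr_ge0 _) (ltW (ln_sublinear _))))//.
  by rewrite invr_gt0.
by rewrite expr2 mulfK// gt_eqF.
Unshelve. all: by end_near. Qed.

Lemma is_derive_mull (c r : R) : is_derive r 1 (fun r => c * r) c.
Proof. by apply: is_derive_eq; rewrite /GRing.scale/=; ring. Qed.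

(* [F] is the radial profile of Re G_k, and F'(r) ~ L r^(1-m) at the origin. *)
Lemma fund_sol_radial (m : nat) (k : R) : m = 2%N \/ m = 3%N -> 0 <= k ->
  exists F G : R -> R, exists L : R,
    [/\ forall y : 'rV[R]_m, complex.Re (fund_sol k y) = F (enorm y), L != 0,
        forall r : R, 0 < r -> is_derive r 1 F (G r / r ^+ m.-1) &
        G r @[r --> 0^'+] --> L].
Proof.
have cvgid : (r : R) @[r --> (0 : R)^'+] --> (0 : R).
  exact/cvg_at_right_filter/cvg_id.
have pi0 := pi_gt0 R.
have pin0 : pi != 0 :> R by rewrite gt_eqF.
move=> [->|->] k0; last first.
  (* Case m = 3: [G] is r^2 F'(r), and [L] is its value at 0, kept unsimplified so that the limit
     passes term by term. *)
  exists (fun r => cos (k * r) / (4 * pi * r)).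
  exists (fun r => - (k * r * sin (k * r) + cos (k * r)) / (4 * pi)).
  exists (- (k * 0 * sin (k * 0) + cos (k * 0)) / (4 * pi)); split.
  - exact: Re_fund_sol3.
  - by rewrite mulr0 mul0r add0r cos0 mulf_neq0// ?oppr_eq0// invr_neq0// mulf_neq0.
  - move=> r r0; have rn0 : r != 0 by rewrite gt_eqF.
    have c0 : 4 * pi * r != 0 by rewrite !mulf_neq0.
    have d1 := is_deriveV c0 (is_derive_mull (4 * pi) r).
    have d2 := is_derive1_comp (is_derive_cos (k * r)) (is_derive_mull k r).
    apply: (@is_derive_eq _ _ _ _ _ _ _ _ (is_deriveM d2 d1)).
    rewrite /GRing.scale/=; move: (pi : R) pin0 => p pin0.
    by field; rewrite ?rn0 ?pin0.
  - have cvgk : k * r @[r --> (0 : R)^'+] --> k * 0 by exact: cvgMr.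
    apply: cvgM; last exact: cvg_cst.
    apply: cvgN; apply: cvgD; last by apply: continuous_cvg => //; exact: continuous_cos.
    by apply: cvgM => //; apply: continuous_cvg => //; exact: continuous_sin.
have [->|kn0] := eqVneq k 0.
  exists (fun r => (2 * pi)^-1 * ln r^-1); exists (fun=> - (2 * pi)^-1).
  exists (- (2 * pi)^-1); split.
  - by move=> y; rewrite /fund_sol eqxx.
  - by rewrite oppr_eq0 invr_neq0// mulf_neq0.
  - move=> r r0; have rn0 : r != 0 by rewrite gt_eqF.
    have d1 := is_deriveV rn0 (is_derive_id r 1).
    have ri0 : 0 < r^-1 by rewrite invr_gt0.
    have d2 := is_derive1_comp (is_derive1_ln ri0) d1.
    have d3 := is_derive1_comp (is_derive_mull (2 * pi)^-1 _) d2.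
    apply: (@is_derive_eq _ _ _ _ _ _ _ _ d3).
    rewrite /GRing.scale/=; move: (pi : R) pin0 => p pin0.
    by field; rewrite ?rn0 ?pin0.
  - exact: cvg_cst.
have k1 : 0 < k by rewrite lt_neqAle eq_sym kn0.
pose A z := limn (pseries J0_coef z); pose A' z := limn (pseries (pseries_diffs J0_coef) z).
pose S z := limn (pseries Y0_coef z); pose S' z := limn (pseries (pseries_diffs Y0_coef) z).
pose w r := (k * r) ^+ 2 / 4.
exists (fun r => - Bessel_Y0 (k * r) / 4).
(* Case m = 2, k > 0: this is r F'(r), with r w'(r) = k^2 r^2 / 2. Every term except [A (w r)]
   carries a factor r^2 or r^2 ln r and vanishes at 0. *)
exists (fun r => - (2 * pi)^-1 * (A (w r) + k ^+ 2 / 2 *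
   ((r ^+ 2 * ln r + r ^+ 2 * (ln (k / 2) + Euler_gamma)) * A' (w r) - r ^+ 2 * S' (w r)))).
exists (- (2 * pi)^-1); split.
- by move=> y; exact: Re_fund_sol2.
- by rewrite oppr_eq0 invr_neq0// mulf_neq0.
- move=> r r0; have rn0 : r != 0 by rewrite gt_eqF.
  have dw : is_derive r 1 w (k ^+ 2 * r / 2).
    by apply: is_derive_eq; rewrite /GRing.scale/=; field.
  have dA := is_derive1_comp (is_derive_pseries_inv_fact (w r) J0_coef_bounded) dw.
  have dS := is_derive1_comp (is_derive_pseries_inv_fact (w r) Y0_coef_bounded) dw.
  have kr0 : 0 < k / 2 * r by rewrite mulr_gt0// divr_gt0.
  have dl := is_derive1_comp (is_derive1_ln kr0) (is_derive_mull (k / 2) r).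
  have dlc := is_deriveD dl (is_derive_cst Euler_gamma r 1).
  have dY := is_deriveB (is_deriveM dlc dA) dS.
  have dF := is_derive1_comp (is_derive_mull (- (2 * pi)^-1) _) dY.
  have -> : (fun r => - Bessel_Y0 (k * r) / 4) =
      (fun z => - (2 * pi)^-1 * ((ln (k / 2 * z) + Euler_gamma) * A (w z) - S (w z))).
    apply/funext => z; rewrite /Bessel_Y0 /Bessel_J0 /= /A /S /w /cst.
    rewrite [k * z / 2]mulrAC.
    by move: (pi : R) pin0 => p pin0; field.
  apply: (@is_derive_eq _ _ _ _ _ _ _ _ dF).
  rewrite /GRing.scale/= -/(A' _) -/(S' _) -/(A _).
  rewrite [X in _ * (X * _ + _ - _)](_ : _ = ln (k / 2) + ln r + Euler_gamma); last first.
    by rewrite -lnM// posrE divr_gt0.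
  by move: (pi : R) pin0 => p pin0; field; rewrite ?rn0 ?kn0 ?pin0.
- have cw : w r @[r --> 0^'+] --> 0.
    rewrite [X in _ --> X](_ : _ = (k * 0) * (k * 0) / 4); last by rewrite !mulr0 mul0r.
    by apply: cvgM; [apply: cvgM; exact: cvgMr|exact: cvg_cst].
  have cA c : inv_fact_bounded c -> limn (pseries c (w r)) @[r --> 0^'+] --> c 0.
    move=> cb; rewrite -pseries_at0.
    exact: (cvg_comp _ _ cw (@continuous_pseries_inv_fact _ c cb 0)).
  have r2 : r ^+ 2 @[r --> (0 : R)^'+] --> (0 : R).
    by rewrite -[X in _ --> X](mulr0 (0 : R)); exact: (cvgM cvgid cvgid).
  (* The limit is put in the shape of the expression; only [J0_coef 0], which is 1, survives. *)
  rewrite [X in _ --> X](_ : _ = - (2 * pi)^-1 * (J0_coef 0 + k ^+ 2 / 2 *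
      ((0 + 0 * (ln (k / 2) + Euler_gamma)) * pseries_diffs J0_coef 0 -
       0 * pseries_diffs Y0_coef 0))); last first.
    by rewrite /J0_coef fact0 expr0 expr1n divr1; ring.
  apply: cvgM; first exact: cvg_cst.
  apply: cvgD; first exact/cA/J0_coef_bounded.
  apply: cvgM; first exact: cvg_cst.
  apply: cvgB; apply: cvgM => //.
  - by apply: cvgD; [exact: cvg_sqr_ln|apply: cvgM => //; exact: cvg_cst].
  - exact/cA/inv_fact_bounded_diffs/J0_coef_bounded.
  - exact/cA/inv_fact_bounded_diffs/Y0_coef_bounded.
Qed.

(** Near 0 the factor [G] of the radial derivative exceeds |L|/2 in absolute value. The exponent is
    m and not m - 1 because the chain rule contributes (y - x)_j / |y - x|. *)
Lemma cgrad_fund_sol_ge (m : nat) (k : R) : m = 2%N \/ m = 3%N -> 0 <= k ->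
  exists c r0 : R, [/\ 0 < c, 0 < r0 &
    forall (x y : 'rV[R]_m) (j : 'I_m), 0 < enorm (y - x) < r0 ->
      c * `|(y - x) 0 j| <=
      `|complex.Re (cgrad (fun y => fund_sol k (y - x)) y 0 j)| * enorm (y - x) ^+ m].
Proof.
move=> hm k0; have [F [G [L [FE L0 dF GL]]]] := fund_sol_radial hm k0.
have Lgt0 : 0 < `|L| / 2 by rewrite divr_gt0// normr_gt0.
have /cvgrPdist_le/(_ _ Lgt0) := GL.
move=> [r0 /= r00 Gr0]; exists (`|L| / 2), r0; split => // x y j /andP[r_gt0 rr0].
set r := enorm (y - x) in r_gt0 rr0 *.
have Gr : `|L| / 2 <= `|G r|.
  have := Gr0 r; rewrite /= sub0r normrN gtr0_norm// => /(_ rr0 r_gt0).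
  have := ler_distD (G r) L 0; rewrite !subr0; lra.
have -> : complex.Re (cgrad (fun y => fund_sol k (y - x)) y 0 j) =
    'D_(delta_mx 0 j) (fun y => F (enorm (y - x))) y.
  by rewrite mxE /= /partial; congr derive; apply/funext => z /=; rewrite FE.
rewrite (@derive_val _ _ _ _ _ _ _ (is_derive_radial j r_gt0 (dF _ r_gt0))) -/r.
have -> : G r / r ^+ m.-1 * ((y - x) 0 j / r) = G r * (y - x) 0 j / r ^+ m.
  have -> : r ^+ m = r ^+ m.-1 * r by rewrite -exprSr; case: hm => ->.
  by rewrite invfM mulrACA.
rewrite normrM normfV (ger0_norm (exprn_ge0 _ (ltW r_gt0))) divfK ?expf_neq0 ?gt_eqF//.
by rewrite normrM ler_wpM2r.
Qed.
End radial.

(** * Cubes inside the cone that avoid the needle *)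

Section geometry.
Context {R : realType} {m : nat}.
Implicit Types (x y z b d w a : 'rV[R]_m).

Lemma dotrDl x y z : dotr (x + y) z = dotr x z + dotr y z.
Proof.
rewrite /dotr -big_split/=; apply: eq_bigr => i _.
by rewrite mxE mulrDl.
Qed.

Lemma dotrZl (t : R) x z : dotr (t *: x) z = t * dotr x z.
Proof. by rewrite /dotr mulr_sumr; apply: eq_bigr => i _; rewrite mxE mulrA. Qed.

Lemma dotr_delta x i : dotr x (delta_mx 0 i) = x 0 i.
Proof.
rewrite /dotr (bigD1 i)//= big1 => [|j ji]; first by rewrite mxE !eqxx mulr1 addr0.
by rewrite mxE (negPf ji) andbF mulr0.
Qed.

Lemma dotrC x y : dotr x y = dotr y x.
Proof. by apply: eq_bigr => i _; rewrite mulrC. Qed.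

Lemma dotr_ge0 x : 0 <= dotr x x.
Proof. by apply: sumr_ge0 => i _; rewrite -expr2 sqr_ge0. Qed.

Lemma enormZ (t : R) x : 0 <= t -> enorm (t *: x) = t * enorm x.
Proof.
move=> t0; rewrite /enorm dotrZl dotrC dotrZl mulrA -expr2.
by rewrite sqrtrM ?sqr_ge0// sqrtr_sqr ger0_norm.
Qed.

Lemma normr_coord_le_enorm x i : `|x 0 i| <= enorm x.
Proof.
rewrite -sqrtr_sqr ler_wsqrtr// /dotr (bigD1 i)//= expr2 lerDl.
by apply: sumr_ge0 => j _; rewrite -expr2 sqr_ge0.
Qed.

Lemma continuous_dotrl b : continuous (fun z => dotr z b).
Proof.
apply: continuous_big => [|i _].
  by move=> p; apply: cvgD; [exact: cvg_fst|exact: cvg_snd].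
by move=> z; apply: continuousM; [exact: coord_continuous|exact: cst_continuous].
Qed.

Lemma continuous_enorm : continuous (@enorm R m).
Proof.
move=> z; apply: (@continuous_comp _ _ _ (fun z => dotr z z) Num.sqrt); last first.
  exact: sqrt_continuous.
apply: (@continuous_big) => [|i _ {}z].
  by move=> p; apply: cvgD; [exact: cvg_fst|exact: cvg_snd].
by apply: continuousM; exact: coord_continuous.
Qed.

(** The angular condition of [finite_cone] alone, with vertex at 0; it is invariant under positive
    dilations. *)
Definition open_cone b (c : R) := [set z | enorm z * enorm b * c < dotr z b].

Lemma open_open_cone b (c : R) : open (open_cone b c).
Proof.
have -> : open_cone b c = (fun z => dotr z b - enorm z * enorm b * c) @^-1` [set s | 0 < s].
  by apply/seteqP; split => z; rewrite /open_cone/= subr_gt0.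
apply: open_comp; last exact: open_gt.
move=> z _.
apply: (@continuousB _ _ _ (fun z => dotr z b) (fun z => enorm z * enorm b * c)).
  exact: continuous_dotrl.
apply: (@continuousM _ _ (fun z => enorm z * enorm b) (fun=> c)); last exact: cst_continuous.
apply: (@continuousM _ _ (@enorm R m) (fun=> enorm b)); last exact: cst_continuous.
exact: continuous_enorm.
Qed.

Lemma open_finite_cone x b (rho theta : R) : open (finite_cone x b rho theta).
Proof.
have -> : finite_cone x b rho theta = (fun y => y - x) @^-1`
    ((@enorm R m) @^-1` [set r | r < rho] `&` open_cone b (cos (theta / 2))) by [].
apply: open_comp.
  by move=> y _; apply: continuousB; [exact: cvg_id|exact: cst_continuous].
apply: openI; last exact: open_open_cone.
by apply: open_comp; [move=> y _; exact: continuous_enorm|exact: open_lt].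
Qed.

(** With [w] the direction of the last piece of the needle, a vector whose product with [a] is
    nonzero cannot be a multiple of [w]. Two coordinates suffice to build [a]. *)
Lemma exists_orthogonal w : (1 < m)%N ->
  exists a (i : 'I_m), a 0 i != 0 /\ dotr w a = 0.
Proof.
move=> m1; pose i0 := Ordinal (ltnW m1); pose i1 := Ordinal m1.
have [w0|w0] := eqVneq (w 0 i0) 0.
  exists (delta_mx 0 i0), i0; rewrite dotr_delta w0 mxE !eqxx.
  by rewrite oner_neq0.
exists (w 0 i1 *: delta_mx 0 i0 - w 0 i0 *: delta_mx 0 i1), i1; split.
  by rewrite !mxE !eqxx mulr0 sub0r mulr1 oppr_eq0.
by rewrite dotrC -scaleNr dotrDl !dotrZl ![dotr (delta_mx _ _) _]dotrC !dotr_delta; ring.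
Qed.

(** The axis [b] lies in the cone because c < 1. If it is orthogonal to [a], a small push along the
    i-th coordinate stays in the open cone and makes the product nonzero. *)
Lemma exists_cone_direction b (c : R) a i : b != 0 -> c < 1 -> a 0 i != 0 ->
  exists d, open_cone b c d /\ dotr d a != 0.
Proof.
move=> b0 c1 ai.
have eb0 : 0 < dotr b b.
  rewrite lt_neqAle dotr_ge0 andbT eq_sym; apply: contra b0 => /eqP b0.
  apply/eqP/rowP => j; rewrite mxE; apply/eqP; rewrite -normr_le0.
  by rewrite (le_trans (normr_coord_le_enorm _ _))// /enorm b0 sqrtr0.
have cb : open_cone b c b.
  by rewrite /open_cone/= -expr2 sqr_sqrtr ?dotr_ge0// gtr_pMr.
have [da|da] := eqVneq (dotr b a) 0; last by exists b.
have /nbhs_ballP[e /= e0 eC] : nbhs b (open_cone b c).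
  by apply: open_nbhs_nbhs; split => //; exact: open_open_cone.
exists (b + (e / 2) *: delta_mx 0 i); split.
  apply: eC; split => // j l; rewrite (ord1 j) /ball/= !mxE.
  rewrite opprD addrA subrr sub0r normrN.
  case: eqP => _; case: eqP => _ /=; rewrite ?mulr1 ?mulr0 ?normr0//.
  by rewrite gtr0_norm ?divr_gt0// ltr_pdivrMr// ltr_pMr// ltr1n.
rewrite dotrDl da add0r dotrZl dotrC dotr_delta mulf_neq0// gt_eqF//.
by rewrite divr_gt0.
Qed.

(* [C] is the needle without its last linear piece. *)
Lemma needle_tip (Omega : set 'rV[R]_m) x (sigma : R -> 'rV[R]_m) :
  needle Omega x sigma ->
  exists w (C : set 'rV[R]_m), [/\ closed C, ~ C x &
    forall y, (sigma @` `[0, 1]) y -> C y \/ exists s, y = x + s *: w].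
Proof.
move=> [[csigma [s ps lin]] injs _ [_ s1] _].
have s0 : (0 < size s)%N.
  by case: s ps lin => // -[_ /= /eqP/esym/eqP]; rewrite oner_eq0.
pose i := (size s).-1.
have is_ : (i < size s)%N by rewrite prednK.
have i1 : nth 0 s i = 1.
  by rewrite -[RHS](itv_partition_nth_size 0 ps) -(prednK s0).
pose u := nth 0 (0 :: s) i.
have u0 : 0 <= u.
  rewrite /u (set_nth_default 1) /=; last exact: ltnW.
  by apply: itv_partition_nth_ge ps; exact: ltnW.
have u1 : u < 1.
  by rewrite -i1; case: ps => /(pathP 0)/(_ i is_).
have [a0 [d0 ad]] := lin i is_.
exists (- d0), (sigma @` `[0, u]); split.
- apply: compact_closed; first exact: norm_hausdorff.
  apply: continuous_compact; last exact: segment_compact.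
  apply: continuous_subspaceW csigma => t /=; rewrite !in_itv/= => /andP[-> tu].
  by rewrite (le_trans tu) ?ltW.
(* Injectivity: [x] is reached only at time 1, which is after [u]. *)
- move=> [t /=]; rewrite in_itv/= => /andP[t0 tu] st.
  have : t = 1.
    apply: injs; rewrite ?s1// !in_itv/= ?ler01 ?lexx// t0/=.
    by rewrite (le_trans tu) ?ltW.
  by move=> t1; move: (le_lt_trans tu u1); rewrite t1 ltxx.
- move=> y [t /=]; rewrite in_itv/= => /andP[t0 t1] <-.
  have [tu|ut] := leP t u; first by left; exists t => //=; rewrite in_itv/= t0.
  (* On the last piece sigma(t) - sigma(1) = (1 - t)(- d0). *)
  right; exists (1 - t); rewrite -s1 (ad t) ?(ad 1) ?i1 ?lexx ?t1 ?(ltW ut) ?ltW//.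
  by apply/rowP => l; rewrite !mxE; ring.
Qed.

(** A closed sup-norm ball in coordinates, the form in which both its measure and its compactness
    are available. *)
Definition cube x (r : R) : set 'rV[R]_m :=
  [set y | forall i, y 0 i \in `[x 0 i - r, x 0 i + r]].

(** Lying in the cone and off the line of the last piece are dilation-invariant open conditions on y
    - x, so a small cube around one good direction [d] can be scaled down to [x]. Near [x] the
    earlier pieces are absent. *)
Lemma cubes_in_cone (Omega : set 'rV[R]_m) x (sigma : R -> 'rV[R]_m) b
    (rho theta : R) : (1 < m)%N -> open Omega -> Omega x ->
  needle Omega x sigma -> b != 0 -> 0 < rho -> 0 < theta < pi ->
  exists d (j : 'I_m) (delta M t0 : R),
    [/\ d 0 j != 0, 0 < delta <= `|d 0 j| / 4, 0 < M, 0 < t0 &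
     forall t y, 0 < t <= t0 -> cube (x + t *: d) (t * delta) y ->
       [/\ finite_cone x b rho theta y, Omega y, ~ (sigma @` `[0, 1]) y &
         enorm (y - x) <= t * M]].
Proof.
move=> m1 oO Ox hs b0 rho0 /andP[th0 thpi].
have c1 : cos (theta / 2) < 1.
  have p0 := pi_ge0 R.
  by rewrite -[ltRHS]cos0 ltr_cos ?divr_gt0// in_itv/=; apply/andP; split; lra.
have [w [C [cC Cx Csig]]] := needle_tip hs.
have [a [i [ai wa]]] := exists_orthogonal w m1.
have [d [dC da]] := exists_cone_direction b0 c1 ai.
have [j dj] : exists j, d 0 j != 0.
  apply: contrapT => /forallNP dj; move/eqP : da; apply.
  by rewrite /dotr big1// => l _; move/negP: (dj l); rewrite negbK => /eqP ->; rewrite mul0r.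
pose M := enorm d + 1.
have M0 : 0 < M by rewrite ltr_wpDl// sqrtr_ge0.
pose W := open_cone b (cos (theta / 2)) `&` [set z | dotr z a != 0] `&`
  [set z | enorm z < M].
have : nbhs d W.
  apply: filterI; first apply: filterI.
  - by apply: open_nbhs_nbhs; split => //; exact: open_open_cone.
  - apply: (@continuous_dotrl a d [set s | s != 0]).
    by apply: open_nbhs_nbhs; split => //; exact: open_neq.
  - apply: (@continuous_enorm d [set s | s < M]).
    by apply: open_nbhs_nbhs; split; [exact: open_lt|rewrite /= ltrDl].
move=> /nbhs_ballP[e /= e0 eW].
have : nbhs x (Omega `&` ~` C).
  by apply: filterI; apply: open_nbhs_nbhs; split => //; exact: closed_openC.
move=> /nbhs_ballP[f /= f0 fW].
have dj0 : 0 < `|d 0 j| by rewrite normr_gt0.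
(* [e / 2] keeps the cube around [d] in [W], and a quarter of |d_j| keeps the j-th coordinate
   comparable to t |d_j|. Dividing by [M] puts the scaled cubes within [rho] and [f] of [x]. *)
exists d, j, (Num.min (e / 2) (`|d 0 j| / 4)), M, (Num.min rho f / M).
have delta0 : 0 < Num.min (e / 2) (`|d 0 j| / 4) by rewrite lt_min !divr_gt0.
have delta1 : Num.min (e / 2) (`|d 0 j| / 4) < e by rewrite gt_min ltr_pdivrMr// ltr_pMr// ltr1n.
split => //.
- by rewrite delta0 ge_min lexx orbT.
- by rewrite divr_gt0// lt_min rho0.
move=> t y /andP[t_gt0 tt0] cy.
pose z := t^-1 *: (y - x).
have yz : y - x = t *: z by rewrite scalerA divff ?scale1r// gt_eqF.
have [[zC za] zM] : W z.
  apply: eW; split => // k l; rewrite (ord1 k) /ball/=.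
  apply: le_lt_trans delta1; have := cy l; rewrite in_itv/= -ler_distl !mxE.
  have -> : y 0 l - (x 0 l + t * d 0 l) = - t * (d 0 l - t^-1 * (y 0 l - x 0 l)).
    by field; rewrite gt_eqF.
  by rewrite normrM normrN (gtr0_norm t_gt0) ler_pM2l.
have tM : t * M <= Num.min rho f by rewrite -ler_pdivlMr.
have eyx : enorm (y - x) < t * M by rewrite yz enormZ ?ltW// ltr_pM2l.
have [Oy Cy] : (Omega `&` ~` C) y.
  apply: fW; split => // k l; rewrite (ord1 k) /ball/= distrC.
  have -> : y 0 l - x 0 l = (y - x) 0 l by rewrite !mxE.
  rewrite (le_lt_trans (normr_coord_le_enorm _ _))// (lt_le_trans eyx)//.
  by rewrite (le_trans tM)// ge_min lexx orbT.
split => //; last exact: ltW.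
- split; first by rewrite (lt_le_trans eyx)// (le_trans tM)// ge_min lexx.
  by rewrite yz dotrZl enormZ ?ltW// -!mulrA ltr_pM2l// mulrA.
- move=> /Csig[//|[s ys]]; move/eqP: za; apply.
  by rewrite /z dotrZl ys addrAC subrr add0r dotrZl wa !mulr0.
Qed.
End geometry.

(** * Norm and measurability of complex gradients *)

Section cnorm.
Context {R : realType} {m : nat}.

Lemma sqr_normc (z : R[i]) :
  Normc.normc z ^+ 2 = complex.Re z ^+ 2 + complex.Im z ^+ 2.
Proof. by case: z => a b; rewrite sqr_sqrtr// addr_ge0// sqr_ge0. Qed.

Lemma normr_Re_le_cnorm (z : 'rV[R[i]]_m) (j : 'I_m) :
  `|complex.Re (z 0 j)| <= cnorm z.
Proof.
rewrite -sqrtr_sqr ler_wsqrtr// (bigD1 j)//= sqr_normc -addrA lerDl.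
by rewrite addr_ge0 ?sqr_ge0// sumr_ge0// => i _; rewrite sqr_ge0.
Qed.

(** From w_j = z_j - (z - w)_j; with z = grad v_n and w = grad G_k this is the splitting used by
    [near_integral_sqr_ge]. *)
Lemma normr_Re_le_cnormD (z w : 'rV[R[i]]_m) (j : 'I_m) :
  `|complex.Re (w 0 j)| <= cnorm z + cnorm (z - w).
Proof.
apply: le_trans (lerD (normr_Re_le_cnorm z j) (normr_Re_le_cnorm (z - w) j)).
rewrite !mxE raddfB/= -[X in `|X| <= _](subKr (complex.Re (z 0 j))).
exact: ler_normB.
Qed.

(** Membership in H^1 ensures that the choice behind [wgrad] returns a genuine weak gradient and not
    the default 0; its components are then measurable. *)
Lemma measurable_cnorm_wgrad (Omega : set 'rV[R]_m) (u : 'rV[R]_m -> R[i]) :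
  H1 Omega u -> measurable_fun Omega (fun y => cnorm (wgrad Omega u y)).
Proof.
move=> [_ [g ug]]; have [L2g _] : is_weak_grad Omega u (wgrad Omega u).
  by apply: (@xgetPex _ (fun=> 0) [set g | is_weak_grad Omega u g]); exists g.
rewrite /cnorm; apply: measurableT_comp.
  by apply: continuous_measurable_fun; exact: sqrt_continuous.
apply: measurable_sum => j; under eq_fun do rewrite sqr_normc.
by have [mRe mIm _] := L2g j; apply: measurable_funD; exact: measurable_funX.
Qed.

End cnorm.

(** * Energy of the needle sequence on one cube *)

Section blow_up.
Context (R : realType) (m : nat).
Local Notation mu := (lebesgue_rV R m).

Lemma measurable_cube (x : 'rV[R]_m) (r : R) : measurable (cube x r).
Proof.
by have [] := @lebesgue_rV_box R m (fun i => [set` `[x 0 i - r, x 0 i + r]])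
  (fun=> measurable_itv _).
Qed.

Lemma lebesgue_cube (x : 'rV[R]_m) (r : R) : 0 < r ->
  mu (cube x r) = ((2 * r) ^+ m)%:E.
Proof.
move=> r0.
have [_] := @lebesgue_rV_box R m (fun i => [set` `[x 0 i - r, x 0 i + r]])
  (fun=> measurable_itv _).
rewrite /cube => ->.
under eq_bigr => i _.
  rewrite lebesgue_measure_itv/= lte_fin ifT; last by lra.
  rewrite -EFinB (_ : _ - _ = 2 * r); last by lra.
  over.
by rewrite prodEFin prodr_const card_ord.
Qed.

Lemma compact_cube (x : 'rV[R]_m) (r : R) : compact (cube x r).
Proof.
have := @rV_compact R m (fun i => [set` `[x 0 i - r, x 0 i + r]]).
by apply=> i; exact: segment_compact.
Qed.


(** The centre has offset t d_j and the cube deviates by at most a quarter of it. The lower bound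
    feeds the gradient estimate, and both bounds together separate cubes of different scales. *)
Lemma cube_coord (x d y : 'rV[R]_m) (j : 'I_m) (t delta : R) :
  0 < t -> delta <= `|d 0 j| / 4 -> cube (x + t *: d) (t * delta) y ->
  t * `|d 0 j| * (3 / 4) <= `|(y - x) 0 j| <= t * `|d 0 j| * (5 / 4).
Proof.
move=> t0 dj /(_ j); rewrite in_itv/= -ler_distl !mxE => yj.
have td : t * delta <= t * (`|d 0 j| / 4) by rewrite ler_pM2l.
have Ntd : `|t * d 0 j| = t * `|d 0 j| by rewrite normrM gtr0_norm.
have E : y 0 j - (x 0 j + t * d 0 j) = y 0 j - x 0 j - t * d 0 j by ring.
rewrite E in yj.
have := ler_normB (y 0 j - x 0 j) (y 0 j - x 0 j - t * d 0 j).
have := ler_normD (t * d 0 j) (y 0 j - x 0 j - t * d 0 j).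
rewrite subKr [t * d 0 j + _]addrC subrK Ntd => ? ?.
by apply/andP; split; lra.
Qed.

Lemma near_cube_integral_ge (Omega : set 'rV[R]_m) (k : R) (x : 'rV[R]_m)
    (sigma : R -> 'rV[R]_m) (v : nat -> 'rV[R]_m -> R[i])
    (p : 'rV[R]_m) (r c : R) (j : 'I_m) :
  open Omega -> needle_sequence Omega k x sigma v -> 0 < r -> 0 < c ->
  cube p r `<=` Omega `\` sigma @` `[0, 1] ->
  (forall y, cube p r y ->
    c <= `|complex.Re (cgrad (fun y => fund_sol k (y - x)) y 0 j)|) ->
  \forall n \near \oo,
    ((c ^+ 2 * (2 * r) ^+ m / 8)%:E <=
     \int[mu]_(y in cube p r) (cnorm (wgrad Omega (v n) y) ^+ 2)%:E)%E.
Proof.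
move=> oO [vH1 vG] r0 c0 KO cG.
apply: (near_integral_sqr_ge (h := fun n y => cnorm (wgrad Omega (v n) y -
    cgrad (fun y => fund_sol k (y - x)) y))) => //.
- exact: measurable_cube.
- exact: lebesgue_cube.
- by rewrite exprn_gt0// mulr_gt0.
- move=> n; have [/measurable_cnorm_wgrad mg _] := vH1 n.
  apply: measurable_funS mg; first exact: open_measurable_rV.
  by move=> y /KO[].
- by move=> n y /cG /le_trans; apply; exact: normr_Re_le_cnormD.
(* The gradient term lies between 0 and the full [H1norm], which tends to 0. *)
- have := vG _ (@compact_cube p r) KO.
  apply: squeeze_cvge; last exact: cvg_cst.
  by apply: nearW => n; rewrite Lnorm_ge0/= leeDr// Lnorm_ge0.
Qed.

End blow_up.

(** * Summation over disjoint cubes shrinking to the vertex *)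

Theorem lemma2p1 (R : realType) (m : nat) (hm : m = 2%N \/ m = 3%N)
  (Omega : set 'rV[R]_m) (hOmega : bounded_domain Omega)
  (hLip : Lipschitz_boundary Omega)
  (k : R) (hk : 0 <= k) (heig : ~ Dirichlet_eigenvalue Omega k 0)
  (x : 'rV[R]_m) (hx : Omega x)
  (sigma : R -> 'rV[R]_m) (hsigma : needle Omega x sigma)
  (v : nat -> 'rV[R]_m -> R[i]) (hv : needle_sequence Omega k x sigma v)
  (b : 'rV[R]_m) (hb : b != 0) (rho : R) (hrho : 0 < rho)
  (theta : R) (htheta : 0 < theta < pi) :
  (\int[lebesgue_rV R m]_(y in finite_cone x b rho theta `&` Omega)
     (cnorm (wgrad Omega (v n) y) ^+ 2)%:E)%E @[n --> \oo] --> +oo%E.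
Proof.
have m1 : (1 < m)%N by case: hm => ->.
have [_ oO _ _] := hOmega.
have [d [j [delta [M [t0 [dj /andP[delta0 deltad] M0 t00 tcube]]]]]] :=
  cubes_in_cone m1 oO hx hsigma hb hrho htheta.
have [c [r0 [c0 r00 cG]]] := @cgrad_fund_sol_ge R m k hm hk.
have dj0 : 0 < `|d 0 j| by rewrite normr_gt0.
(* [t0] places the cubes, 1 makes higher powers of t smaller, and r0/(2M) keeps |y - x| strictly
   below [r0]. *)
pose tm := Num.min t0 (Num.min 1 (r0 / (2 * M))).
have tm0 : 0 < tm by rewrite !lt_min t00 ltr01 divr_gt0// mulr_gt0.
pose t i := tm / 4 ^+ i.
have t_gt0 i : 0 < t i by rewrite divr_gt0// exprn_gt0.
have ttm i : t i <= tm.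
  by rewrite ler_pdivrMr ?exprn_gt0// (ler_peMr (ltW tm0))// exprn_ege1// ler1n.
have tt0 i : t i <= t0 by rewrite (le_trans (ttm i))// ge_min lexx.
have t1 i : t i <= 1 by rewrite (le_trans (ttm i))// !ge_min lexx !orbT.
have tr0 i : t i * M < r0.
  have : t i <= r0 / (2 * M) by rewrite (le_trans (ttm i))// !ge_min lexx !orbT.
  rewrite -(ler_pM2r M0) => /le_lt_trans; apply.
  by rewrite invfM mulrA divfK ?gt_eqF// ltr_pdivrMr// ltr_pMr// ltr1n.
pose K i := cube (x + t i *: d) (t i * delta).
have mK i : measurable (K i) by exact: measurable_cube.
have Kcone i y : K i y -> [/\ finite_cone x b rho theta y, Omega y,
    ~ (sigma @` `[0, 1]) y & enorm (y - x) <= t i * M].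
  by apply: tcube; rewrite t_gt0 tt0.
(* The quotient of c t |d_j| (3/4) by (t M)^m is kappa / t^(m-1). *)
pose kappa := c * `|d 0 j| * (3 / 4) / M ^+ m.
have kappa0 : 0 < kappa by rewrite !mulr_gt0// invr_gt0 exprn_gt0.
have KG i y : K i y -> kappa / t i ^+ m.-1 <=
    `|complex.Re (cgrad (fun y => fund_sol k (y - x)) y 0 j)|.
  move=> Ky; have [_ _ _ eyx] := Kcone _ _ Ky.
  have /andP[yj _] := cube_coord (t_gt0 i) deltad Ky.
  have yx0 : 0 < enorm (y - x).
    apply: lt_le_trans (normr_coord_le_enorm _ j).
    by apply: lt_le_trans yj; rewrite !mulr_gt0.
  have := cG x y j; rewrite yx0 (le_lt_trans eyx)// => /(_ isT) cGy.
  have cGy' : c * (t i * `|d 0 j| * (3 / 4)) <=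
      `|complex.Re (cgrad (fun y => fund_sol k (y - x)) y 0 j)| * (t i * M) ^+ m.
    apply: le_trans (le_trans _ cGy) _; first by rewrite ler_pM2l.
    rewrite ler_wpM2l//; apply: lerXn2r => //; first by rewrite nnegrE ltW.
    by rewrite nnegrE ltW// mulr_gt0.
  rewrite -(ler_pM2r (exprn_gt0 m (mulr_gt0 (t_gt0 i) M0))).
  apply: le_trans cGy'.
  have -> : (t i * M) ^+ m = t i ^+ m.-1 * t i * M ^+ m.
    by rewrite exprMn -exprSr prednK// ltnW.
  rewrite /kappa le_eqVlt; apply/orP; left; apply/eqP; field.
  by rewrite !expf_neq0 ?gt_eqF.
(* The one-cube bound at scale t = 1; smaller scales only increase it. *)
pose eta := kappa ^+ 2 * (2 * delta) ^+ m / 8.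
have eta0 : 0 < eta by rewrite divr_gt0// mulr_gt0// exprn_gt0// mulr_gt0.
have Keta i : \forall n \near \oo, (eta%:E <=
    \int[lebesgue_rV R m]_(y in K i) (cnorm (wgrad Omega (v n) y) ^+ 2)%:E)%E.
  have KO : K i `<=` Omega `\` sigma @` `[0, 1] by move=> y /Kcone[].
  have td0 : 0 < t i * delta by rewrite mulr_gt0.
  have kt0 : 0 < kappa / t i ^+ m.-1 by rewrite divr_gt0// exprn_gt0.
  apply: filterS (near_cube_integral_ge oO hv td0 kt0 KO (KG i)) => n.
  apply: le_trans; rewrite lee_fin /eta ler_pM2r//.
  have -> : (kappa / t i ^+ m.-1) ^+ 2 * (2 * (t i * delta)) ^+ m =
      kappa ^+ 2 * (2 * delta) ^+ m * (t i ^+ m / (t i ^+ m.-1) ^+ 2).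
    by rewrite expr_div_n [2 * (_ * _)]mulrCA [(t i * _) ^+ m]exprMn; ring.
  (* The scale factor t^m / t^(2m-2) is at least 1, as t <= 1 and m <= 2m - 2 for m = 2, 3. *)
  apply: ler_peMr; first by rewrite ltW// mulr_gt0// exprn_gt0// mulr_gt0.
  rewrite -exprM ler_pdivlMr ?exprn_gt0// mul1r; apply: ler_wiXn2l => //.
    exact: ltW.
  by case: hm => ->.
(* A common point would give (3/4) t_i <= (5/4) t_N <= (5/16) t_i after division by |d_j|, which is
   impossible. *)
have Kdisj N : (\bigcup_(i < N) K i) `&` K N = set0.
  apply/seteqP; split => // y [[i /= iN Kiy] KNy].
  have /andP[yi _] := cube_coord (t_gt0 i) deltad Kiy.
  have /andP[_ yN] := cube_coord (t_gt0 N) deltad KNy.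
  have tNi : t N <= t i / 4.
    rewrite /t -mulrA -invfM -exprSr ler_pM2l// lef_pV2 ?posrE ?exprn_gt0//.
    by rewrite ler_eXn2l// ltr1n.
  have : t N * `|d 0 j| <= t i / 4 * `|d 0 j| by rewrite ler_pM2r.
  have : 0 < t i * `|d 0 j| by rewrite mulr_gt0.
  by move: yi yN; lra.
have mg n : measurable_fun Omega (fun y => (cnorm (wgrad Omega (v n) y) ^+ 2)%:E).
  have [/(_ n)[vH1 _] _] := hv.
  by apply/measurable_EFinP; apply: measurable_funX; exact: measurable_cnorm_wgrad.
have mU N : measurable (\bigcup_(i < N) K i) by exact: bigcup_measurable.
have UO N : \bigcup_(i < N) K i `<=` Omega by move=> y [i _ /Kcone[]].
have mO : measurable Omega by exact: open_measurable_rV.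
(* By induction on N, since each new disjoint cube adds [eta] for all large n. *)
have UN N : \forall n \near \oo, ((N%:R * eta)%:E <=
    \int[lebesgue_rV R m]_(y in \bigcup_(i < N) K i) (cnorm (wgrad Omega (v n) y) ^+ 2)%:E)%E.
  elim: N => [|N IHN].
    apply: nearW => n; rewrite mul0r; apply: integral_ge0 => y _.
    by rewrite lee_fin sqr_ge0.
  have US : \bigcup_(i < N.+1) K i = \bigcup_(i < N) K i `|` K N.
    by rewrite IIS bigcup_setU bigcup_set1.
  apply: filterS2 IHN (Keta N) => n IH KNn.
  rewrite US ge0_integral_setU//=.
  - by rewrite -addn1 natrD mulrDl mul1r EFinD leeD.
  - by apply: measurable_funS (mg n) => //; rewrite -US.
  - by move=> y _; rewrite lee_fin sqr_ge0.
  - by rewrite disj_set2E Kdisj.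
apply/cvgeyPge => A.
have [N AN] : exists N, A <= N%:R * eta.
  exists (Num.bound `|A / eta|); rewrite -ler_pdivrMr//.
  by rewrite (le_trans (ler_norm _))// ltW// archi_boundP.
apply: filterS (UN N) => n IH; apply: le_trans (le_trans IH _); first by rewrite lee_fin.
apply: ge0_subset_integral => //.
- by apply: measurableI => //; apply: open_measurable_rV; exact: open_finite_cone.
- by apply: measurable_funS (mg n).
- by move=> y _; rewrite lee_fin sqr_ge0.
- by move=> y [i _ /Kcone[]].
Qed.
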